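(* Let $n$ be a positive integer and $\mathbf b=(b_1,\dots,b_n)\in\mathbb Z_{>0}^n$, not with $n=1=b_1$. The lifted $\mathbf b$-parking-function polytope $\overline{\mathfrak X}_n(\mathbf b)\subset\mathbb R^{n+1}$ is a generalized permutahedron.
   Context: A $\mathbf b$-parking function is a list $(\beta_1,\dots,\beta_n)$ of positive integers whose nondecreasing rearrangement $\beta'_1\le\cdots\le\beta'_n$ satisfies $\beta'_i\le b_1+\cdots+b_i$ for all $i$. The $\mathbf b$-parking-function polytope $\mathfrak X_n(\mathbf b)\subset\mathbb R^n$ is the convex hull of all $\mathbf b$-parking functions. Let $S_i=\sum_{j=1}^i b_j$, $B=\sum_{k=1}^n S_k$, and let $\ell:\mathbb R^n\to\mathbb R^{n+1}$ be the affine map $(x_1,\dots,x_n)\mapsto\left(x_1,\dots,x_n,\,B-\sum_{i=1}^n x_i\right)$. The lifted $\mathbf b$-parking-function polytope is $\overline{\mathfrak X}_n(\mathbf b)=\ell(\mathfrak X_n(\mathbf b))$. A polytope in $\mathbb R^m$ is a generalized permutahedron if each of its edges is parallel to $\mathbf e_i-\mathbf e_j$ for some standard basis vectors $\mathbf e_i,\mathbf e_j$ of $\mathbb R^m$. *)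

(* Defs.v *)
From mathcomp Require Import all_boot all_order all_algebra.
From mathcomp Require Import boolp classical_sets reals.

Set Implicit Arguments.
Unset Strict Implicit.
Unset Printing Implicit Defensive.

Import Order.TTheory GRing.Theory Num.Theory.

Local Open Scope classical_set_scope.
Local Open Scope ring_scope.

Section Polytopes.
Variables (R : realType) (m : nat).
Implicit Types (A P F : set 'rV[R]_m) (v : 'rV[R]_m).

Definition convex_hull A : set 'rV[R]_m :=
  [set x | exists k (p : 'I_k -> 'rV[R]_m) (w : 'I_k -> R),
     [/\ forall i, A (p i), forall i, 0 <= w i, \sum_i w i = 1
       & x = \sum_i w i *: p i]].

Definition affine_hull A : set 'rV[R]_m :=
  [set x | exists k (p : 'I_k -> 'rV[R]_m) (w : 'I_k -> R),
     [/\ forall i, A (p i), \sum_i w i = 1 & x = \sum_i w i *: p i]].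

(* The affine hull of A is a translate of a d-dimensional linear subspace,
   given as the row space of a d x m matrix of rank d. In particular A is
   nonempty. *)
Definition has_dim A (d : nat) : Prop :=
  exists (x0 : 'rV[R]_m) (D : 'M[R]_(d, m)),
    row_free D /\ affine_hull A = [set x | (x - x0 <= D)%MS].

Definition is_polytope P : Prop :=
  exists s : seq 'rV[R]_m, P = convex_hull [set` s].

Definition dotp (c x : 'rV[R]_m) : R := \sum_i c 0 i * x 0 i.

(* c = 0 gives F = P, so P is a face of itself. *)
Definition is_face P F : Prop :=
  exists c : 'rV[R]_m,
    F = [set x | P x /\ forall y, P y -> dotp c y <= dotp c x].

Definition is_edge P F : Prop := is_face P F /\ has_dim F 1.

Definition parallel A v : Prop :=
  forall x y, A x -> A y -> exists t : R, x - y = t *: v.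

Definition basis_vec (i : 'I_m) : 'rV[R]_m := delta_mx 0 i.

Definition generalized_permutahedron P : Prop :=
  is_polytope P /\
  forall F, is_edge P F ->
    exists i j : 'I_m, i != j /\ parallel F (basis_vec i - basis_vec j).

End Polytopes.

Section ParkingFunctions.
Variables (n : nat) (b : 'I_n -> nat).

(* Indices are 0-based: psum i is b_1 + ... + b_(i+1). *)
Definition psum (i : 'I_n) : nat := (\sum_(j < n | (j <= i)%N) b j)%N.

Definition is_parking_function (beta : n.-tuple nat) : Prop :=
  (forall i : 'I_n, (0 < tnth beta i)%N) /\
  (forall i : 'I_n, (nth 0%N (sort leq beta) i <= psum i)%N).

Variable R : realType.

Definition vec_of_list (beta : n.-tuple nat) : 'rV[R]_n :=
  \row_i (tnth beta i)%:R.

Definition parking_polytope : set 'rV[R]_n :=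
  convex_hull (vec_of_list @` is_parking_function).

Definition lift_map (x : 'rV[R]_n) : 'rV[R]_(n + 1) :=
  row_mx x (const_mx ((\sum_(k < n) psum k)%N%:R - \sum_i x 0 i)).

Definition lifted_parking_polytope : set 'rV[R]_(n + 1) :=
  lift_map @` parking_polytope.

End ParkingFunctions.

Arguments parking_polytope {n} b R _ : assert.
Arguments lifted_parking_polytope {n} b R _ : assert.

(* Main.v *)
(* On an edge, the maximizing functional is, up to a constant, a weight
   sum_i a_i beta_i on parking functions. Resetting a coordinate with a_i <= 0
   to 1, or swapping two coordinates whose order disagrees with that of a, does
   not decrease the weight, and the resulting difference of lifted points is a
   multiple of some e_i - e_j. If no such move links two maximizers, then any
   two of them are comonotone; their coordinatewise maximum is therefore again a
   parking function, and comparing weights forces them to be equal. So an edge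
   contains two distinct points whose difference is parallel to some e_i - e_j,
   which, the edge being one-dimensional, settles its direction. *)

Require Import Defs.
From mathcomp Require Import all_boot all_order all_algebra.
From mathcomp Require Import boolp classical_sets reals.
From mathcomp Require Import perm.

Set Implicit Arguments.
Unset Strict Implicit.
Unset Printing Implicit Defensive.

Import Order.TTheory GRing.Theory Num.Theory.

Local Open Scope classical_set_scope.
Local Open Scope ring_scope.

(** * Parking functions through sublevel sets, and moves preserving them *)

Lemma nth_sorted_leqE (s : seq nat) (k v : nat) :
  sorted leq s -> (k < size s)%N ->
  (nth 0%N s k <= v)%N = (k < count (fun x => x <= v)%N s)%N.
Proof.
elim: s k => [//|x s IH] k /= xs.
case: (leqP x v) => [xv|vx].
  by case: k => [|k] //= ks; rewrite ?xv // IH // (path_sorted xs).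
(* Sortedness puts every entry above [v] here, so both sides are false. *)
have gtv y : y \in x :: s -> (y <= v)%N = false.
  rewrite inE => /orP[/eqP ->|ys]; first by rewrite leqNgt vx.
  by rewrite leqNgt (leq_trans vx) // (allP (order_path_min leq_trans xs)).
move=> ks; rewrite (gtv _ (mem_nth 0%N (s := x :: s) ks)).
rewrite add0n (@eq_in_count _ _ pred0) ?count_pred0 // => y ys.
by rewrite gtv // inE ys orbT.
Qed.

Section ParkingFunctionTheory.
Variables (n : nat) (b : 'I_n -> nat).
Implicit Types beta gamma : n.-tuple nat.

(** Counting small entries removes the sorting, so that stability under a move reduces to comparing
    cardinalities of sublevel sets. *)
Lemma parking_functionP beta :
  is_parking_function b beta <->
  (forall i, 0 < tnth beta i)%N /\
  (forall k : 'I_n, k < #|[set i | tnth beta i <= psum b k]%SET|)%N.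
Proof.
suff E (k : 'I_n) : (nth 0%N (sort leq beta) k <= psum b k)%N =
    (k < #|[set i | tnth beta i <= psum b k]%SET|)%N.
  by split=> -[pos H]; split=> // k; move: (H k); rewrite E.
rewrite nth_sorted_leqE ?(sort_sorted leq_total) ?size_sort ?size_tuple //.
rewrite count_sort -{1}(map_tnth_enum beta) count_map cardsE cardE /enum_mem size_filter.
by rewrite count_filter; congr (_ < _)%N; apply: eq_count => i; rewrite /= andbT.
Qed.

(** This uniform bound is what makes the parking functions finite in number. *)
Lemma parking_function_bound beta i :
  is_parking_function b beta -> (tnth beta i <= \sum_j b j)%N.
Proof.
move=> [_ H]; have : tnth beta i \in sort leq beta by rewrite mem_sort mem_tnth.
case/(nthP 0%N)=> k; rewrite size_sort size_tuple => kn <-.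
apply: leq_trans (H (Ordinal kn)) _.
by rewrite /psum [leqRHS](bigID (fun j : 'I_n => j <= k)%N) /= leq_addr.
Qed.

Definition reset beta (i : 'I_n) : n.-tuple nat :=
  [tuple if k == i then 1%N else tnth beta k | k < n].

Definition swap beta (i j : 'I_n) : n.-tuple nat :=
  [tuple tnth beta (tperm i j k) | k < n].

Definition join beta gamma : n.-tuple nat :=
  [tuple maxn (tnth beta k) (tnth gamma k) | k < n].

Lemma parking_reset beta i :
  is_parking_function b beta -> is_parking_function b (reset beta i).
Proof.
rewrite !parking_functionP => -[pos H]; split=> k.
  by rewrite tnth_mktuple; case: ifP.
apply: leq_trans (H k) _; apply/subset_leq_card/fintype.subsetP=> j.
(* The new entry 1 is at most the positive entry it replaces, so no index leaves the sublevel
   set. *)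
rewrite !inE tnth_mktuple; case: eqP => // _ le.
by apply: leq_trans le; apply: pos.
Qed.

Lemma parking_swap beta i j :
  is_parking_function b beta -> is_parking_function b (swap beta i j).
Proof.
rewrite !parking_functionP => -[pos H]; split=> k; first by rewrite tnth_mktuple.
(* The transposition carries one sublevel set onto the other. *)
rewrite (_ : finset _ = tperm i j @: [set l | tnth beta l <= psum b k]%SET)%N.
  by rewrite card_imset //; exact: perm_inj.
apply/setP=> l; rewrite -[in RHS](tpermK i j l) mem_imset ?inE ?tnth_mktuple //.
exact: perm_inj.
Qed.

(* Comonotonicity makes the sublevel sets of beta and gamma nested, so each
   sublevel set of the join is one of theirs. *)
Lemma parking_join beta gamma :
  is_parking_function b beta -> is_parking_function b gamma ->
  (forall i j, tnth beta i < tnth beta j -> tnth gamma i <= tnth gamma j)%N ->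
  is_parking_function b (join beta gamma).
Proof.
rewrite !parking_functionP => -[posb Hb] [posg Hg] mono; split=> k.
  by rewrite tnth_mktuple leq_max posb.
set s := psum b k.
have [/fintype.subsetP sub|/fintype.subsetPn[i]] :=
    boolP ([set i | tnth beta i <= s] \subset [set i | tnth gamma i <= s])%SET%N.
  apply: leq_trans (Hb k) _; apply/subset_leq_card/fintype.subsetP=> i ib.
  by move: ib (sub i ib); rewrite !inE tnth_mktuple geq_max => -> ->.
rewrite !inE -ltnNge => bi gi.
apply: leq_trans (Hg k) _; apply/subset_leq_card/fintype.subsetP=> j.
rewrite !inE tnth_mktuple geq_max -/s => gj; rewrite gj andbT leqNgt.
apply/negP => bj; have := mono i j (leq_ltn_trans bi bj).
by rewrite leqNgt (leq_ltn_trans gj gi).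
Qed.

(** * Maximizers of a linear weight over parking functions *)

Section Maximizers.
Variables (R : realType) (a : 'I_n -> R).

Definition weight beta : R := \sum_i a i * (tnth beta i)%:R.

Definition maximizer beta : Prop :=
  is_parking_function b beta /\
  forall gamma, is_parking_function b gamma -> weight gamma <= weight beta.

Lemma maximizer_le beta gamma :
  maximizer beta -> is_parking_function b gamma ->
  weight beta <= weight gamma -> maximizer gamma.
Proof. by move=> [_ H] pg le; split=> // d /H /le_trans; apply. Qed.

Lemma vec_reset beta i :
  vec_of_list R beta - vec_of_list R (reset beta i) =
  ((tnth beta i)%:R - 1) *: delta_mx 0 i.
Proof.
apply/rowP=> k; rewrite !mxE tnth_mktuple eqxx /=.
by case: eqP => [->|_]; rewrite ?mulr1 // mulr0 subrr.
Qed.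

Lemma vec_swap beta i j :
  vec_of_list R beta - vec_of_list R (swap beta i j) =
  ((tnth beta i)%:R - (tnth beta j)%:R) *: (delta_mx 0 i - delta_mx 0 j).
Proof.
apply/rowP=> k; rewrite !mxE tnth_mktuple eqxx /=.
have [-> |ki] := eqVneq k i; rewrite ?tpermL.
  have [-> |_] := eqVneq i j; first by rewrite subrr mul0r.
  by rewrite subr0 mulr1.
have [-> |kj] := eqVneq k j; first by rewrite tpermR sub0r mulrN mulr1 opprB.
by rewrite tpermD 1?eq_sym // !subrr mulr0.
Qed.

Lemma weightB beta gamma :
  weight beta - weight gamma =
  \sum_i a i * (vec_of_list R beta - vec_of_list R gamma) 0 i.
Proof. by rewrite -sumrB; apply: eq_bigr => i _; rewrite !mxE mulrBr. Qed.

Lemma sum_delta (i : 'I_n) t : \sum_k a k * (t *: delta_mx 0 i : 'rV[R]_n) 0 k = t * a i.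
Proof.
rewrite (bigD1 i) //= big1 => [|k ki]; rewrite !mxE eqxx /=.
  by rewrite eqxx mulr1 addr0 mulrC.
by rewrite (negbTE ki) !mulr0.
Qed.

Lemma weight_reset beta i :
  weight beta - weight (reset beta i) = ((tnth beta i)%:R - 1) * a i.
Proof. by rewrite weightB vec_reset sum_delta. Qed.

Lemma weight_swap beta i j :
  weight beta - weight (swap beta i j) =
  ((tnth beta i)%:R - (tnth beta j)%:R) * (a i - a j).
Proof.
rewrite weightB vec_swap scalerBr mulrBr -!sum_delta -sumrB.
by apply: eq_bigr => k _; rewrite -mulrBr !mxE.
Qed.

Definition elementary_step (v : 'rV[R]_n) : Prop :=
  exists2 t : R, t != 0 &
    (exists i, v = t *: delta_mx 0 i) \/
    (exists i j, i != j /\ v = t *: (delta_mx 0 i - delta_mx 0 j)).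

Section NoStep.
Hypothesis nostep : forall beta gamma, maximizer beta -> maximizer gamma ->
  ~ elementary_step (vec_of_list R beta - vec_of_list R gamma).

(** Otherwise resetting entry [i] would give another maximizer, one elementary step away. *)
Lemma maximizer_eq1 beta i : maximizer beta -> a i <= 0 -> tnth beta i = 1%N.
Proof.
move=> mb ai; have [[pos _] _] := (mb).
have ge1 : 1 <= (tnth beta i)%:R :> R by rewrite (ler_nat R 1) pos.
have [//|ne] := eqVneq (tnth beta i) 1%N; exfalso.
apply: (@nostep beta (reset beta i)) => //.
  apply: (maximizer_le mb (parking_reset i mb.1)).
  by rewrite -subr_le0 weight_reset mulr_ge0_le0 // subr_ge0.
exists ((tnth beta i)%:R - 1); last by left; exists i; rewrite vec_reset.
by rewrite subr_eq0 (eqr_nat R _ 1).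
Qed.

(** The inequality on [a] is strict because, for equal coefficients too, the swap would be a second
    maximizer. *)
Lemma maximizer_comonotone beta i j :
  maximizer beta -> (tnth beta i < tnth beta j)%N -> a i < a j.
Proof.
move=> mb lt; rewrite ltNge; apply/negP => le.
apply: (@nostep beta (swap beta i j)) => //.
  apply: (maximizer_le mb (parking_swap i j mb.1)).
  rewrite -subr_le0 weight_swap mulr_le0_ge0 ?subr_ge0 //.
  by rewrite subr_le0 ler_nat ltnW.
exists ((tnth beta i)%:R - (tnth beta j)%:R).
  by rewrite subr_eq0 eqr_nat neq_ltn lt.
right; exists i, j; split; last exact: vec_swap.
by apply: contraTneq lt => ->; rewrite ltnn.
Qed.

Lemma maximizer_geq beta gamma i :
  maximizer beta -> maximizer gamma -> (tnth gamma i <= tnth beta i)%N.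
Proof.
move=> mb mg; have [[posb _] _] := (mb).
have pj : is_parking_function b (join beta gamma).
  (* A strict order of two entries in either maximizer forces the same strict order in [a], so the
     two cannot disagree. *)
  apply: parking_join mb.1 mg.1 _ => k l /(maximizer_comonotone mb) akl.
  rewrite leqNgt; apply/negP => /(maximizer_comonotone mg).
  by rewrite ltNge (ltW akl).
(* Such an entry of [gamma] exceeds 1, which a nonpositive coefficient forbids. *)
have apos k : (tnth beta k < tnth gamma k)%N -> 0 < a k.
  move=> lt; rewrite ltNge; apply/negP => /(maximizer_eq1 mg) g1.
  by move: lt; rewrite g1 ltnNge posb.
rewrite leqNgt; apply/negP => lti.
have := mb.2 _ pj; rewrite -subr_le0 weightB leNgt => /negP; apply.
(* The join gains strictly at [i] and loses nowhere, contradicting the maximality of [beta]. *)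
rewrite (bigD1 i) //= ltr_wpDr //.
  apply: sumr_ge0 => k _; rewrite !mxE tnth_mktuple.
  case: (leqP (tnth gamma k) (tnth beta k)) => [_|lt]; first by rewrite subrr mulr0.
  by rewrite mulr_ge0 ?ltW ?apos // subr_gt0 ltr_nat.
by rewrite !mxE tnth_mktuple mulr_gt0 ?apos // subr_gt0 ltr_nat leq_max lti orbT.
Qed.

End NoStep.

Lemma maximizer_elementary_step beta gamma :
  maximizer beta -> maximizer gamma -> beta != gamma ->
  exists beta' gamma', [/\ maximizer beta', maximizer gamma' &
    elementary_step (vec_of_list R beta' - vec_of_list R gamma')].
Proof.
move=> mb mg /eqP ne; apply: contrapT => no; apply: ne.
have nostep beta' gamma' : maximizer beta' -> maximizer gamma' ->
    ~ elementary_step (vec_of_list R beta' - vec_of_list R gamma').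
  by move=> m1 m2 st; apply: no; exists beta', gamma'.
apply: eq_from_tnth => i; apply/eqP.
by rewrite eqn_leq !(maximizer_geq nostep).
Qed.

End Maximizers.
End ParkingFunctionTheory.

(** * Faces of convex hulls and one-dimensional sets *)

Section ConvexSets.
Variables (R : realType) (m : nat).
Implicit Types (A F : set 'rV[R]_m) (c x y : 'rV[R]_m).

Lemma subset_convex_hull A x : A x -> convex_hull A x.
Proof.
move=> Ax; exists 1%N, (fun=> x), (fun=> 1).
by split=> //; rewrite big_ord1 ?scale1r.
Qed.

Lemma dotp_sum c k (w : 'I_k -> R) (p : 'I_k -> 'rV[R]_m) :
  dotp c (\sum_i w i *: p i) = \sum_i w i * dotp c (p i).
Proof.
transitivity (\sum_i \sum_l w i * (c 0 l * p i 0 l)).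
  rewrite exchange_big; apply: eq_bigr => l _; rewrite summxE mulr_sumr.
  by apply: eq_bigr => i _; rewrite mxE mulrCA.
by apply: eq_bigr => i _; rewrite mulr_sumr.
Qed.

(** A point of a face is a combination of generators lying on that face; if these all coincide, so
    does the point with them. *)
Lemma face_point_unique A F x y :
  is_face (convex_hull A) F -> F x -> F y ->
  (forall p q, A p -> A q -> F p -> F q -> p = q) -> x = y.
Proof.
move=> [c FE] + + uniq.
have vertex z : F z -> exists q, [/\ A q, F q & z = q].
  rewrite {1}FE => -[[k [p [w [Ap w0 w1 zE]]]] zmax].
  have Fp i : w i != 0 -> F (p i).
    move=> wi; suff cp : dotp c (p i) = dotp c z.
      rewrite FE; split; first exact: subset_convex_hull.
      by move=> u /zmax; rewrite cp.
    (* These weighted gaps are nonnegative and sum to zero, so the gap vanishes wherever the weight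
       does not. *)
    have ge0 l : true -> 0 <= w l * (dotp c z - dotp c (p l)).
      by rewrite mulr_ge0 // subr_ge0; apply/zmax/subset_convex_hull.
    have /(psumr_eq0P ge0)/(_ i isT)/eqP :
        \sum_l w l * (dotp c z - dotp c (p l)) = 0.
      under eq_bigr do rewrite mulrBr.
      by rewrite sumrB -mulr_suml w1 mul1r -dotp_sum -zE subrr.
    by rewrite mulf_eq0 (negbTE wi) subr_eq0 => /eqP.
  have [i wi] : exists i, w i != 0.
    apply: contrapT => no; move: w1; rewrite big1 => [/esym/eqP|i _].
      by rewrite oner_eq0.
    by apply: contrapT => /eqP wi; apply: no; exists i.
  exists (p i); split=> //; first exact: Fp.
  rewrite zE.
  rewrite -[RHS]scale1r -w1 scaler_suml; apply: eq_bigr => l _.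
  have [-> |wl] := eqVneq (w l) 0; first by rewrite !scale0r.
  by rewrite (uniq _ _ (Ap l) (Ap i) (Fp _ wl) (Fp _ wi)).
by move=> /vertex[p [Ap Fp ->]] /vertex[q [Aq Fq ->]]; apply: uniq.
Qed.

Lemma has_dim1_two_points F : has_dim F 1 -> exists x y, [/\ F x, F y & x != y].
Proof.
move=> [x0 [D [Dfree FE]]]; apply: contrapT => no.
have eqF x y : F x -> F y -> x = y.
  by move=> Fx Fy; apply: contrapT => /eqP xy; apply: no; exists x, y.
have hull_eq x y : affine_hull F x -> affine_hull F y -> x = y.
  move=> [k [p [w [Fp w1 ->]]]] [l [q [v [Fq v1 ->]]]].
  (* Weights with sum 1 exclude the empty family. *)
  have [i _] : exists i : 'I_k, true.
    case: k p w Fp w1 => [|k] p w Fp w1; last by exists ord0.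
    by move: w1; rewrite big_ord0 => /esym/eqP; rewrite oner_eq0.
  rewrite (eq_bigr (fun j => w j *: p i)) => [|j _]; last
    by rewrite (eqF _ _ (Fp j) (Fp i)).
  rewrite [RHS](eq_bigr (fun j => v j *: p i)) => [|j _]; last
    by rewrite (eqF _ _ (Fq j) (Fp i)).
  by rewrite -!scaler_suml w1 v1.
(* [D] has one row, hence is itself a vector, and both points lie in the affine hull; but rank 1
   excludes [D = 0]. *)
have : x0 = x0 + D.
  by apply: hull_eq; rewrite FE /= ?subrr ?sub0mx // addrC addKr submx_refl.
move=> /esym/eqP; rewrite -subr_eq0 addrC addKr => /eqP D0.
by move: Dfree; rewrite D0 /row_free mxrank0.
Qed.

(** All differences in [F] are multiples of one row [D], and a nonzero multiple can serve in its
    place. *)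
Lemma has_dim1_parallel F x y :
  has_dim F 1 -> F x -> F y -> x != y -> parallel F (x - y).
Proof.
move=> [x0 [D [_ FE]]] Fx Fy xy.
have onD u v : F u -> F v -> exists t, u - v = t *: D.
  have coord z : F z -> exists t, z - x0 = t *: D.
    move=> Fz; apply/sub_rVP; suff : affine_hull F z by rewrite FE.
    exists 1%N, (fun=> z), (fun=> 1).
    by split=> //; rewrite big_ord1 ?scale1r.
  move=> /coord[s us] /coord[t vt]; exists (s - t).
  by rewrite scalerBl -us -vt opprB addrA subrK.
have [s sE] := onD x y Fx Fy; move=> u v Fu Fv; have [t ->] := onD u v Fu Fv.
have s0 : s != 0 by apply: contraNneq xy => s0; rewrite -subr_eq0 sE s0 scale0r.
by exists (t / s); rewrite sE scalerA divfK.
Qed.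

End ConvexSets.

(** * The lift to one more coordinate and its edge directions *)

Section Lift.
Variables (R : realType) (n : nat) (b : 'I_n -> nat).
Implicit Types (x v : 'rV[R]_n) (beta gamma : n.-tuple nat).

(** The linear part of the affine map [lift_map]. *)
Definition tangent v : 'rV[R]_(n + 1) :=
  row_mx v (const_mx (- \sum_i v 0 i)).

Lemma lift_mapB x y : lift_map b x - lift_map b y = tangent (x - y).
Proof.
rewrite /lift_map /tangent opp_row_mx add_row_mx; congr row_mx.
apply/rowP=> k; rewrite !mxE.
under [in RHS]eq_bigr do rewrite !mxE.
by rewrite sumrB !opprB addrC addrA subrK.
Qed.

Lemma tangent_delta (t : R) i :
  tangent (t *: delta_mx 0 i) =
  t *: (basis_vec R (lshift 1 i) - basis_vec R (rshift n ord0)).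
Proof.
have sumt : \sum_k (t *: delta_mx 0 i : 'rV[R]_n) 0 k = t.
  rewrite (bigD1 i) //= big1 => [|k ki]; rewrite !mxE eqxx /=.
    by rewrite eqxx mulr1 addr0.
  by rewrite (negbTE ki) mulr0.
rewrite /tangent sumt; apply/rowP=> k; rewrite -(splitK k).
case: (fintype.split k) => l /=.
  rewrite row_mxEl !mxE !eqxx /= eq_lshift eq_lrshift.
  by rewrite subr0.
rewrite row_mxEr !mxE !eqxx /= eq_rlshift eq_rshift (ord1 l) eqxx.
by rewrite sub0r mulrN1.
Qed.

Lemma tangentB v w : tangent (v - w) = tangent v - tangent w.
Proof.
rewrite /tangent opp_row_mx add_row_mx; congr row_mx.
apply/rowP=> k; rewrite !mxE.
under eq_bigr do rewrite !mxE.
by rewrite sumrB opprB opprK addrC.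
Qed.

Lemma tangent_elementary_step v : elementary_step v ->
  exists t i j, [/\ t != 0, i != j &
    tangent v = t *: (basis_vec R i - basis_vec R j)].
Proof.
move=> [t t0 [[i ->]|[i [j [ij ->]]]]].
  exists t, (lshift 1 i), (rshift n ord0).
  by rewrite tangent_delta eq_lrshift.
exists t, (lshift 1 i), (lshift 1 j); rewrite eq_lshift; split=> //.
rewrite scalerBr tangentB !tangent_delta -scalerBr.
by rewrite opprB addrA subrK.
Qed.

(** Weights with sum 1 reproduce the constant term of the affine map. *)
Lemma lift_map_sum k (w : 'I_k -> R) (p : 'I_k -> 'rV[R]_n) :
  \sum_i w i = 1 ->
  lift_map b (\sum_i w i *: p i) = \sum_i w i *: lift_map b (p i).
Proof.
move=> w1; apply/rowP=> l; rewrite -(splitK l) summxE.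
case: (fintype.split l) => j /=.
  rewrite row_mxEl summxE; apply: eq_bigr => i _.
  by rewrite [RHS]mxE row_mxEl mxE.
rewrite row_mxEr mxE.
under [RHS]eq_bigr do rewrite mxE row_mxEr mxE mulrBr.
rewrite sumrB -mulr_suml w1 mul1r; congr (_ - _).
under [LHS]eq_bigr do rewrite summxE.
rewrite exchange_big; apply: eq_bigr => i _; rewrite mulr_sumr.
by apply: eq_bigr => q _; rewrite mxE.
Qed.

Definition lifted_parking_vectors : set 'rV[R]_(n + 1) :=
  (fun beta => lift_map b (vec_of_list R beta)) @` is_parking_function b.

Lemma lifted_parking_polytopeE :
  lifted_parking_polytope b R = convex_hull lifted_parking_vectors.
Proof.
apply/seteqP; split=> x.
  move=> [y [k [p [w [Ap w0 w1 ->]]]] <-].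
  exists k, (fun i => lift_map b (p i)), w; split=> //; last exact: lift_map_sum.
  by move=> i; have [beta pb <-] := Ap i; exists beta.
move=> [k [p [w [Ap w0 w1 ->]]]].
have /choice[beta betaE] : forall i, exists beta,
    is_parking_function b beta /\ lift_map b (vec_of_list R beta) = p i.
  by move=> i; have [beta pb <-] := Ap i; exists beta.
exists (\sum_i w i *: vec_of_list R (beta i)).
  exists k, (fun i => vec_of_list R (beta i)), w; split=> // i.
  by exists (beta i) => //; apply: (betaE i).1.
by rewrite lift_map_sum //; apply: eq_bigr => i _; rewrite (betaE i).2.
Qed.

Lemma lifted_parking_vectors_finite :
  exists s : seq 'rV[R]_(n + 1), lifted_parking_vectors = [set` s].
Proof.
pose N := (\sum_j b j)%N.
pose pf (t : n.-tuple 'I_N.+1) := `[< is_parking_function b (map_tuple val t) >].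
exists [seq lift_map b (vec_of_list R (map_tuple val t)) | t <- enum pf].
apply/seteqP; split=> x /=.
  (* The default value of [inord] never occurs, since [N] bounds every entry. *)
  move=> [beta pb <-]; pose t : n.-tuple 'I_N.+1 := [tuple inord (tnth beta i) | i < n].
  have tE : map_tuple val t = beta.
    apply: eq_from_tnth => i; rewrite tnth_map tnth_mktuple [LHS]inordK //.
    by rewrite ltnS parking_function_bound.
  apply/mapP; exists t; last by rewrite tE.
  by rewrite mem_enum; apply/asboolP; rewrite tE.
case/mapP=> t; rewrite mem_enum => /asboolP pt ->.
by exists (map_tuple val t).
Qed.

(* Eliminating the last coordinate turns a functional on the lift into one on
   parking functions, up to a constant. *)
Lemma dotp_lift (c : 'rV[R]_(n + 1)) beta gamma :
  let a i := c 0 (lshift 1 i) - c 0 (rshift n ord0) in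
  dotp c (lift_map b (vec_of_list R beta)) - dotp c (lift_map b (vec_of_list R gamma)) =
  weight a beta - weight a gamma.
Proof.
move=> a; rewrite weightB /dotp -sumrB.
under eq_bigr => i _.
  have -> : c 0 i * lift_map b (vec_of_list R beta) 0 i
      - c 0 i * lift_map b (vec_of_list R gamma) 0 i
    = c 0 i * tangent (vec_of_list R beta - vec_of_list R gamma) 0 i.
    by rewrite -mulrBr -lift_mapB !mxE.
  over.
rewrite big_split_ord /= big_ord1 row_mxEr mxE mulrN mulr_sumr -sumrB.
by apply: eq_bigr => i _; rewrite row_mxEl mulrBl.
Qed.

Lemma edge_parallel (F : set 'rV[R]_(n + 1)) :
  is_edge (lifted_parking_polytope b R) F ->
  exists i j, i != j /\ parallel F (basis_vec R i - basis_vec R j).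
Proof.
rewrite lifted_parking_polytopeE => -[face dim1].
have [x [y [Fx Fy /eqP xy]]] := has_dim1_two_points dim1.
(* With a single generator on it, the face would be a point. *)
have [beta [gamma [pb pg Fb Fg ne]]] : exists beta gamma,
    [/\ is_parking_function b beta, is_parking_function b gamma,
        F (lift_map b (vec_of_list R beta)), F (lift_map b (vec_of_list R gamma))
      & beta != gamma].
  apply: contrapT => no; apply: xy; apply: (face_point_unique face Fx Fy).
  move=> _ _ [beta pb <-] [gamma pg <-] Fb Fg; apply: contrapT => ne.
  apply: no; exists beta, gamma; split=> //.
  by apply/eqP => e; apply: ne; rewrite e.
have [c FE] := face.
pose a i := c 0 (lshift 1 i) - c 0 (rshift n ord0).
have hullL d : is_parking_function b d ->
    convex_hull lifted_parking_vectors (lift_map b (vec_of_list R d)).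
  by move=> pd; apply: subset_convex_hull; exists d.
have maxF d : is_parking_function b d ->
    F (lift_map b (vec_of_list R d)) -> maximizer b a d.
  move=> pd; rewrite FE => -[_ dmax]; split=> // e pe.
  by rewrite -subr_ge0 -dotp_lift subr_ge0; apply/dmax/hullL.
have Fmax d : maximizer b a d -> F (lift_map b (vec_of_list R d)).
  move=> [pd dmax]; rewrite FE; split; first exact: hullL.
  (* The lift of [beta] attains the maximum over the whole hull, so it suffices that [d] weighs at
     least as much. *)
  move: Fb; rewrite FE => -[_ bmax] z /bmax /le_trans; apply.
  by rewrite -subr_ge0 dotp_lift subr_ge0 dmax.
have [b' [g' [mb mg step]]] := maximizer_elementary_step (maxF _ pb Fb) (maxF _ pg Fg) ne.
have [t [i [j [t0 ij tE]]]] := tangent_elementary_step step.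
exists i, j; split=> // u v Fu Fv.
(* The difference is [t] times a vector whose coordinate [i] is 1. *)
have ne' : lift_map b (vec_of_list R b') != lift_map b (vec_of_list R g').
  rewrite -subr_eq0 lift_mapB tE scaler_eq0 negb_or t0 /= subr_eq0.
  apply/eqP => /rowP/(_ i); rewrite !mxE !eqxx (negbTE ij) /= => /eqP.
  by rewrite oner_eq0.
have [s ->] := has_dim1_parallel dim1 (Fmax _ mb) (Fmax _ mg) ne' Fu Fv.
by exists (s * t); rewrite lift_mapB tE scalerA.
Qed.

End Lift.

Theorem theorem2p11 (R : realType) (n : nat) (b : 'I_n -> nat)
    (n_gt0 : (0 < n)%N)
    (b_gt0 : forall i : 'I_n, (0 < b i)%N)
    (not_trivial : ~ (n = 1%N /\ forall i : 'I_n, b i = 1%N)) :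
  generalized_permutahedron (lifted_parking_polytope b R).
Proof.
split; last exact: edge_parallel.
have [s sE] := lifted_parking_vectors_finite R b.
by exists s; rewrite -sE lifted_parking_polytopeE.
Qed.
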